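(* In the unital subshift $C^*$-algebra $\mathcal{O}_{\mathsf{X}}$ of $\mathsf{X}=\mathbb{H}^{\mathbb{Q}}_{\mathrm{Berk}}(\mathbb{C}_p)$ the following hold: (i) $s_q^*s_p=\delta_{q,p}\,p_{F_q}$ for all $q,p\in\mathbb{Q}_1$; (ii) $s_\alpha^*s_\alpha$ and $s_\beta^*s_\beta$ commute for all $\alpha,\beta\in\mathcal{L}_{\mathsf{X}}$; (iii) $s_\alpha^*s_\alpha$ and $s_\beta s_\beta^*$ commute for all $\alpha,\beta\in\mathcal{L}_{\mathsf{X}}$; (iv) $s_\alpha s_\beta=0$ for all $\alpha,\beta\in\mathcal{L}_{\mathsf{X}}$ such that $\alpha\beta\notin\mathcal{L}_{\mathsf{X}}$; (v) $\mathcal{O}_{\mathsf{X}}$ is generated by the set $\{s_q,s_q^*:q\in\mathbb{Q}_1\}\cup\{1\}$.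
   Context: Let $\mathbb{Q}_1=\mathbb{Q}\cap(0,1)$, enumerated as $(q_n)_{n\ge1}$, and let $b_n\in[0,1]$ with $q_n<b_n$ and $b_n-q_n\to0$. Let $f:[0,1]\to2^{[0,1]}$ be the set-valued (comb) function with graph $\{(t,t):t\in[0,1]\}\cup\bigcup_n[q_n,b_n]\times\{q_n\}$, and $X=\{(x_1,x_2,\dots)\in[0,1]^{\mathbb{N}}:x_k\in f(x_{k+1})\ \forall k\}$. This is homeomorphic to Ważewski's universal dendrite, with which $\mathbb{P}^1_{\mathrm{Berk}}(\mathbb{C}_p)$ is identified. Under this identification the set of type II (branching) points is $$\mathbb{H}^{\mathbb{Q}}_{\mathrm{Berk}}(\mathbb{C}_p)=\{x\in X: x=(q_{i_1}^{k_1},\dots,q_{i_{m-1}}^{k_{m-1}},q_{i_m}^\infty),\ q_{i_\ell}<q_{i_{\ell+1}}\}\subseteq\mathbb{Q}_1^{\mathbb{N}},$$ where $a^k$ means $a$ repeated $k>0$ times. It is invariant under the shift $\sigma(x_n)=(x_{n+1})$. Write $\mathsf{X}=\mathbb{H}^{\mathbb{Q}}_{\mathrm{Berk}}(\mathbb{C}_p)$. The language $\mathcal{L}_{\mathsf{X}}$ is the set of all finite words, including the empty word $\emptyset$, that appear in some sequence of $\mathsf{X}$. For $\alpha,\beta\in\mathcal{L}_{\mathsf{X}}$ let $C(\alpha,\beta)=\{\beta x\in\mathsf{X}:\alpha x\in\mathsf{X}\}$, $Z_\beta=C(\emptyset,\beta)$ (cylinder set), $F_\alpha=C(\alpha,\emptyset)$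 (follower set). Let $\mathcal{U}$ be the Boolean algebra of subsets of $\mathsf{X}$ generated by all $C(\alpha,\beta)$. $\mathcal{O}_{\mathsf{X}}$ is the universal unital $C^*$-algebra generated by projections $\{p_A:A\in\mathcal{U}\}$ and partial isometries $\{s_a:a\in\mathbb{Q}_1\}$ subject to: (1) $p_{\mathsf{X}}=1$, $p_{A\cap B}=p_Ap_B$, $p_{A\cup B}=p_A+p_B-p_{A\cap B}$, $p_\emptyset=0$ for $A,B\in\mathcal{U}$; (2) $s_\beta s_\alpha^*s_\alpha s_\beta^*=p_{C(\alpha,\beta)}$ for all $\alpha,\beta\in\mathcal{L}_{\mathsf{X}}$, where $s_\emptyset=1$ and $s_\alpha=s_{\alpha_1}\cdots s_{\alpha_n}$ for $\alpha=\alpha_1\cdots\alpha_n$ (for a word $\alpha\beta\notin\mathcal{L}_{\mathsf X}$, $s_\alpha s_\beta$ is just the product). *)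

(* Defs.v *)
From HB Require Import structures.
From mathcomp Require Import all_boot all_order all_algebra.
From mathcomp Require Import all_classical all_reals all_analysis.
From mathcomp Require Import complex.
Set Implicit Arguments.
Unset Strict Implicit.
Unset Printing Implicit Defensive.
Import Order.TTheory GRing.Theory Num.Theory.
Import numFieldNormedType.Exports.
Local Open Scope classical_set_scope.
Local Open Scope ring_scope.

(** * Unital C*-algebras *)

(* MathComp algebras satisfy 1 != 0, so the zero C*-algebra is not an instance.
   The norm is kept apart from the normed modules of MathComp-Analysis: there is
   no structure joining a noncommutative algebra and a normed module, and HB
   cannot add one above the existing hierarchy. *)
HB.mixin Record isCstar (R : realType) A of GRing.Algebra R[i] A := {
  star : A -> A;
  cnorm : A -> R;
  starD : forall x y, star (x + y) = star x + star y;
  starZ : forall (c : R[i]) x, star (c *: x) = c^* *: star x;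
  starM : forall x y, star (x * y) = star y * star x;
  starK : forall x, star (star x) = x;
  cnorm_ge0 : forall x, 0 <= cnorm x;
  cnorm_eq0 : forall x, cnorm x = 0 -> x = 0;
  cnormD : forall x y, cnorm (x + y) <= cnorm x + cnorm y;
  cnormZ : forall (c : R[i]) x, cnorm (c *: x) = complex.Re `|c| * cnorm x;
  cnormM : forall x y, cnorm (x * y) <= cnorm x * cnorm y;
  cstar_identity : forall x, cnorm (star x * x) = cnorm x ^+ 2;
  cnorm_complete : forall u : nat -> A,
    (forall e : R, 0 < e -> exists N, forall m n,
      (N <= m)%N -> (N <= n)%N -> cnorm (u m - u n) < e) ->
    exists l, (fun n => cnorm (u n - l)) @ \oo --> (0 : R)
}.

#[short(type="cstarType")]
HB.structure Definition Cstar (R : realType) :=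
  {A of isCstar R A & GRing.Algebra R[i] A}.

Section CstarNotions.
Variables (R : realType) (A : cstarType R).

Definition is_projection (x : A) := star x = x /\ x * x = x.

Definition is_partial_isometry (x : A) := x * star x * x = x.

Definition cnorm_closed (M : set A) := forall (u : nat -> A) (l : A),
  (forall n, M (u n)) -> (fun n => cnorm (u n - l)) @ \oo --> (0 : R) -> M l.

(* Not required to contain 1. *)
Definition cstar_subalgebra (M : set A) :=
  [/\ cnorm_closed M /\ M 0,
      forall x y, M x -> M y -> M (x + y),
      forall (c : R[i]) x, M x -> M (c *: x),
      forall x y, M x -> M y -> M (x * y) &
      forall x, M x -> M (star x)].

Definition cstar_generated_by (G : set A) := smallest cstar_subalgebra G = setT.

End CstarNotions.

(** * The unital C*-algebra of a subshift over an arbitrary alphabet *)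

Section Words.
Variable T : Type.
Implicit Types (w : seq T) (x : nat -> T) (X : set (nat -> T)).

Definition prepend w x : nat -> T :=
  fun n => if (n < size w)%N then nth (x 0%N) w n else x (n - size w)%N.

Definition language X : set (seq T) :=
  [set w | exists2 x, X x & exists n, w = [seq x (n + i)%N | i <- iota 0 (size w)]].

Definition Cset X (al be : seq T) : set (nat -> T) :=
  [set prepend be x | x in [set x | X (prepend be x) /\ X (prepend al x)]].

Definition cylinder X be := Cset X [::] be.
Definition follower X al := Cset X al [::].

Definition boolean_algebra X (M : set (set (nat -> T))) :=
  [/\ M set0, M X,
      forall B C, M B -> M C -> M (B `&` C),
      forall B C, M B -> M C -> M (B `|` C) &
      forall B, M B -> M (X `\` B)].

Definition Ualg X : set (set (nat -> T)) :=
  smallest (boolean_algebra X)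
    [set B | exists al be, [/\ language X al, language X be & B = Cset X al be]].

End Words.

Section SubshiftAlgebra.
Variables (R : realType) (T : Type) (X : set (nat -> T)).

Definition word_prod (A : cstarType R) (s : T -> A) (w : seq T) : A :=
  \prod_(a <- w) s a.

(* Only the values of p on Ualg X are meaningful. *)
Record subshift_relations (A : cstarType R)
    (p : set (nat -> T) -> A) (s : T -> A) : Prop := SubshiftRelations {
  rel_proj : forall B, Ualg X B -> is_projection (p B);
  rel_piso : forall a, is_partial_isometry (s a);
  rel_pX : p X = 1;
  rel_pI : forall B C, Ualg X B -> Ualg X C -> p (B `&` C) = p B * p C;
  rel_pU : forall B C, Ualg X B -> Ualg X C ->
    p (B `|` C) = p B + p C - p (B `&` C);
  rel_p0 : p set0 = 0;
  rel_C : forall al be, language X al -> language X be ->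
    word_prod s be * star (word_prod s al) * word_prod s al
      * star (word_prod s be) = p (Cset X al be)
}.

(* (A, p, s) is the universal unital C*-algebra generated by the p_B and s_a
   subject to the relations, determined up to unique isomorphism by its
   universal property; phi below is unique since A is generated by the p_B
   and s_a. *)
Definition is_subshift_algebra (A : cstarType R)
    (p : set (nat -> T) -> A) (s : T -> A) : Prop :=
  [/\ subshift_relations p s,
      cstar_generated_by (p @` Ualg X `|` range s) &
      forall (B : cstarType R) (p' : set (nat -> T) -> B) (s' : T -> B),
        subshift_relations p' s' ->
        exists phi : {lrmorphism A -> B},
          [/\ forall x, phi (star x) = star (phi x),
              forall C, Ualg X C -> phi (p C) = p' C &
              forall a, phi (s a) = s' a]].

End SubshiftAlgebra.

(** * The universal dendrite as an inverse limit, and its type II points *)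

Definition Q1 := {a : rat | 0 < a < 1}.

Definition Q1_lt (a c : Q1) : bool := sval a < sval c.

Section Dendrite.
Variable R : realType.

Definition Q1_real (a : Q1) : R := ratr (sval a).

Variables (q : nat -> Q1) (b : nat -> R).

Definition comb_graph : set (R * R) :=
  [set z | z.1 \in `[0, 1] /\ z.2 = z.1] `|`
  \bigcup_n (`[Q1_real (q n), b n] `*` [set Q1_real (q n)]).

Definition comb (t : R) : set R := [set y | comb_graph (t, y)].

Definition dendrite : set (nat -> R) :=
  [set x | forall k, x k \in `[0, 1] /\ comb (x k.+1) (x k)].

(* x = (a_1^{k_1}, ..., a_{m-1}^{k_{m-1}}, c^oo), where
   w = [:: (a_1, k_1); ...; (a_{m-1}, k_{m-1})]. *)
Definition typeII : set (nat -> Q1) :=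
  [set x : nat -> Q1 | dendrite (Q1_real \o x) /\
    exists (w : seq (Q1 * nat)) (c : Q1),
      [/\ all (fun e => 0 < e.2)%N w,
          sorted Q1_lt (rcons (map fst w) c) &
          x = prepend (flatten [seq nseq e.2 e.1 | e <- w]) (fun=> c)]].

End Dendrite.

(* Main.v *)
Require Import Defs.
From HB Require Import structures.
From mathcomp Require Import all_boot all_order all_algebra.
From mathcomp Require Import all_classical all_reals all_analysis.
From mathcomp Require Import complex.
Import Order.TTheory GRing.Theory Num.Theory.
Import numFieldNormedType.Exports.
Local Open Scope classical_set_scope.
Local Open Scope ring_scope.

Set Implicit Arguments.
Unset Strict Implicit.
Unset Printing Implicit Defensive.

(** The five assertions are formal consequences of the defining relations and
    of the fact that the p_B and s_a generate the algebra.

    Taking one of the two words to be empty, the relation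
    s_be s_al^* s_al s_be^* = p_{C(al, be)} says that s_al^* s_al is the
    projection p of the follower set F_al and s_be s_be^* the projection p of
    the cylinder Z_be. As p turns intersections into products, all these
    projections commute, which is (ii) and (iii). By the C*-identity, s_al then
    absorbs its source projection on the right and its range projection on the
    left, even though a product of partial isometries need not be a partial
    isometry in general. Hence
      s_al s_be = s_al p_{F_al} p_{Z_be} s_be,
      s_a^* s_c = s_a^* p_{Z_a} p_{Z_c} s_c,
    and products vanish as soon as the two sets are disjoint: F_al and Z_be are
    disjoint when al be is not in the language, which is (iv), and Z_a and Z_c
    are disjoint for a <> c, which is (i) off the diagonal. Finally, the sets B for which p_B
    lies in a given unital C*-subalgebra form a Boolean algebra; if the
    subalgebra contains all s_a, it contains the p_{C(al, be)} by the
    relation above, hence every p_B, which is (v).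

    For (i) one needs that every letter is a word of the language; it is,
    because the constant sequences belong to the inverse limit. *)

(** * Projections in C*-algebras *)

Section CstarLemmas.
Variables (R : realType) (A : cstarType R).
Implicit Types x y e : A.

Lemma star1 : star (1 : A) = 1.
Proof. by rewrite -[LHS]mulr1 -{2}[1]starK -starM mulr1 starK. Qed.

Lemma starB x y : star (x - y) = star x - star y.
Proof. by apply/eqP; rewrite eq_sym subr_eq -starD subrK. Qed.

Lemma cnorm0 : cnorm (0 : A) = 0.
Proof. by rewrite -(scale0r (0 : A)) cnormZ normr0 mul0r. Qed.

Lemma star_mul_eq0 x : star x * x = 0 -> x = 0.
Proof.
move=> xx0; apply: cnorm_eq0; apply/eqP.
by rewrite -sqrf_eq0 -cstar_identity xx0 cnorm0.
Qed.

(** The C*-identity reduces this to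
    (x - x e)^* (x - x e) = e - e e - e e + e e e = 0. *)
Lemma mul_source_projection x e : is_projection e -> star x * x = e -> x * e = x.
Proof.
move=> [eS eI] xe; apply/esym/eqP; rewrite -subr_eq0; apply/eqP.
apply: star_mul_eq0.
rewrite starB starM eS mulrBl !mulrBr -!mulrA !(mulrA (star x) x) xe.
by rewrite !eI !subrr.
Qed.

Lemma mul_range_projection x e : is_projection e -> x * star x = e -> e * x = x.
Proof.
move=> pe xe; rewrite -[RHS]starK -(@mul_source_projection (star x) e) ?starK//.
by rewrite starM starK pe.1.
Qed.

Lemma smallest_cstar_subalgebra (G : set A) :
  cstar_subalgebra (smallest (@cstar_subalgebra R A) G).
Proof.
split.
- split=> [u l uM ul M [MA GM]|M [[[_ M0] _ _ _ _] _]//].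
  have [[Mc _] _ _ _ _] := MA.
  by apply: (Mc u) => // n; apply: uM; split.
- move=> x y xM yM M [MA GM]; have [_ MD _ _ _] := MA.
  by apply: MD; [apply: xM | apply: yM]; split.
- move=> c x xM M [MA GM]; have [_ _ MZ _ _] := MA.
  by apply: MZ; apply: xM; split.
- move=> x y xM yM M [MA GM]; have [_ _ _ MM _] := MA.
  by apply: MM; [apply: xM | apply: yM]; split.
- move=> x xM M [MA GM]; have [_ _ _ _ MS] := MA.
  by apply: MS; apply: xM; split.
Qed.

Lemma cstar_subalgebraB (M : set A) x y :
  cstar_subalgebra M -> M x -> M y -> M (x - y).
Proof. by move=> [_ MD MZ _ _] Mx My; rewrite -scaleN1r; apply/MD/MZ. Qed.

Lemma word_prod_mem (M : set A) (T : Type) (s : T -> A) w :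
  cstar_subalgebra M -> M 1 -> (forall a, M (s a)) -> M (word_prod s w).
Proof.
move=> [_ _ _ MM _] M1 Ms; elim: w => [|a w IH]; first by rewrite /word_prod big_nil.
by rewrite /word_prod big_cons; apply: MM.
Qed.

End CstarLemmas.

(** * Cylinders and follower sets *)

Section WordLemmas.
Variable T : Type.
Implicit Types (w al be : seq T) (x : nat -> T) (X : set (nat -> T)).

Lemma prepend_nil x : prepend [::] x = x.
Proof. by apply/funext => n; rewrite /prepend ltn0 subn0. Qed.

Lemma prepend_cat al be x : prepend (al ++ be) x = prepend al (prepend be x).
Proof.
apply/funext => n; rewrite /prepend size_cat nth_cat.
have [lt_n|le_n] := ltnP n (size al).
  by rewrite (leq_trans lt_n (leq_addr _ _)); apply: set_nth_default.
by rewrite subnDA ltn_subLR.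
Qed.

Lemma language_prepend X w x : X (prepend w x) -> language X w.
Proof.
move=> Xwx; exists (prepend w x) => //; exists 0%N.
apply: (@eq_from_nth _ (x 0%N)); rewrite ?size_map ?size_iota// => i lt_i.
by rewrite (nth_map 0%N) ?size_iota// nth_iota// /prepend !add0n lt_i.
Qed.

Lemma language_nil X x : X x -> language X [::].
Proof. by move=> Xx; apply: (@language_prepend _ _ x); rewrite prepend_nil. Qed.

Lemma Cset_subset X al be : Cset X al be `<=` X.
Proof. by move=> _ [x [Xx _] <-]. Qed.

Lemma follower_cylinder_disjoint X al be :
  ~ language X (al ++ be) -> follower X al `&` cylinder X be = set0.
Proof.
move=> Nlang; rewrite -subset0 => _ [[x [_ Xalx] <-] [y _]].
rewrite prepend_nil => xE; apply: Nlang.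
by apply: (@language_prepend _ _ y); rewrite prepend_cat xE.
Qed.

Lemma letter_cylinder_disjoint X (a c : T) :
  a <> c -> cylinder X [:: a] `&` cylinder X [:: c] = set0.
Proof.
move=> neq; rewrite -subset0 => _ [[x _ <-] [y _ /(congr1 (@^~ 0%N))]].
by move=> /= /esym.
Qed.

Lemma boolean_algebra_Ualg X : boolean_algebra X (Ualg X).
Proof.
split.
- by move=> M [[]].
- by move=> M [[]].
- move=> B C UB UC M [MA GM]; have [_ _ MI _ _] := MA.
  by apply: MI; [apply: UB | apply: UC]; split.
- move=> B C UB UC M [MA GM]; have [_ _ _ MU _] := MA.
  by apply: MU; [apply: UB | apply: UC]; split.
- move=> B UB M [MA GM]; have [_ _ _ _ MD] := MA.
  by apply: MD; apply: UB; split.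
Qed.

Lemma Ualg_Cset X al be :
  language X al -> language X be -> Ualg X (Cset X al be).
Proof. by move=> Lal Lbe M [_]; apply; exists al, be. Qed.

End WordLemmas.

(** * Consequences of the subshift relations *)

Section SubshiftRelationsLemmas.
Variables (R : realType) (T : Type) (X : set (nat -> T)) (A : cstarType R).
Variables (p : set (nat -> T) -> A) (s : T -> A).
Hypothesis rels : subshift_relations X p s.
Implicit Types (al be w : seq T).

Lemma word_prod0 : word_prod s [::] = 1.
Proof. by rewrite /word_prod big_nil. Qed.

Lemma word_prod1 (a : T) : word_prod s [:: a] = s a.
Proof. by rewrite /word_prod big_seq1. Qed.

Lemma language0 w : language X w -> language X [::].
Proof. by case=> x Xx _; apply: (language_nil Xx). Qed.

Lemma source_word_prod al : language X al ->
  star (word_prod s al) * word_prod s al = p (follower X al).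
Proof.
move=> Lal; rewrite -(rel_C rels Lal (language0 Lal)).
by rewrite word_prod0 star1 mul1r mulr1.
Qed.

Lemma range_word_prod be : language X be ->
  word_prod s be * star (word_prod s be) = p (cylinder X be).
Proof.
move=> Lbe; rewrite -(rel_C rels (language0 Lbe) Lbe).
by rewrite word_prod0 star1 !mulr1.
Qed.

Lemma comm_pUalg B C : Ualg X B -> Ualg X C -> GRing.comm (p B) (p C).
Proof.
by move=> UB UC; rewrite /GRing.comm -!(rel_pI rels) ?(setIC B).
Qed.

Lemma Ualg_follower al : language X al -> Ualg X (follower X al).
Proof. by move=> L; apply: Ualg_Cset (language0 L). Qed.

Lemma Ualg_cylinder al : language X al -> Ualg X (cylinder X al).
Proof. by move=> L; apply: Ualg_Cset (language0 L) _. Qed.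

(** Insert the source projection of [s_al] and the range projection of [s_be]
    in the middle; their product is [p] of an empty intersection. *)
Lemma word_prod_mul_eq0 al be : language X al -> language X be ->
  ~ language X (al ++ be) -> word_prod s al * word_prod s be = 0.
Proof.
move=> Lal Lbe Nlang.
have UF := Ualg_follower Lal; have UZ := Ualg_cylinder Lbe.
rewrite -(mul_source_projection (rel_proj rels UF) (source_word_prod Lal)).
rewrite -(mul_range_projection (rel_proj rels UZ) (range_word_prod Lbe)).
rewrite -mulrA (mulrA (p _) (p _)) -(rel_pI rels)//.
by rewrite follower_cylinder_disjoint// (rel_p0 rels) mul0r mulr0.
Qed.

Lemma star_letter_mul_eq0 (a c : T) :
  language X [:: a] -> language X [:: c] -> a <> c -> star (s a) * s c = 0.
Proof.
move=> La Lc neq.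
have UA := Ualg_cylinder La; have UC := Ualg_cylinder Lc.
have ra := range_word_prod La; have rc := range_word_prod Lc.
rewrite !word_prod1 in ra rc.
rewrite -(mul_range_projection (rel_proj rels UA) ra).
rewrite -(mul_range_projection (rel_proj rels UC) rc).
rewrite starM (rel_proj rels UA).1 -mulrA (mulrA (p _) (p _)) -(rel_pI rels)//.
by rewrite letter_cylinder_disjoint// (rel_p0 rels) mul0r mulr0.
Qed.

Lemma pUalg_setD B : Ualg X B -> B `<=` X -> p (X `\` B) = 1 - p B.
Proof.
move=> UB BX; have [_ _ _ _ UD] := boolean_algebra_Ualg X.
have := rel_pU rels UB (UD _ UB).
rewrite setDUK// setDIK (rel_p0 rels) (rel_pX rels) subr0 => ->.
by rewrite addrC addKr.
Qed.

(** The relations let [p] be computed along the Boolean operations and express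
    it through the [s_a] on the generators [C(al, be)]. Complements are taken
    in [X], so the induction carries [B `<=` X] along. *)
Lemma pUalg_mem (M : set A) B : cstar_subalgebra M -> M 1 ->
  (forall a, M (s a)) -> Ualg X B -> M (p B).
Proof.
move=> MA M1 Ms UB; have [[_ M0] MD _ MM MS] := MA.
have [U0 UX UI UU UD] := boolean_algebra_Ualg X.
suff : [set B | [/\ Ualg X B, B `<=` X & M (p B)]] B by case.
apply: UB; split; first split => /=.
- by split=> //; rewrite (rel_p0 rels).
- by split=> //; rewrite (rel_pX rels).
- move=> C D [UC CX MC] [UD' DX MD']; split; [exact: UI|by move=> x [/CX]|].
  by rewrite (rel_pI rels)//; apply: MM.
- move=> C D [UC CX MC] [UD' DX MD']; split; [exact: UU|by rewrite subUset|].
  rewrite (rel_pU rels)//; apply: cstar_subalgebraB => //; first exact: MD.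
  by rewrite (rel_pI rels)//; apply: MM.
- move=> C [UC CX MC]; split; [exact: UD|exact: subDsetl|].
  by rewrite pUalg_setD//; apply: cstar_subalgebraB.
- move=> _ [al [be [Lal Lbe ->]]]; split; [exact: Ualg_Cset|exact: Cset_subset|].
  have Mw w : M (word_prod s w) by apply: word_prod_mem.
  rewrite -(rel_C rels)//; apply: (MM _ _ _ (MS _ (Mw be))).
  by apply: (MM _ _ _ (Mw al)); apply: (MM _ _ (Mw be)); apply: MS.
Qed.

End SubshiftRelationsLemmas.

(** * Type II points of the dendrite *)

Section TypeII.
Variables (R : realType) (q : nat -> Q1) (b : nat -> R).

Lemma Q1_real01 (a : Q1) : Q1_real R a \in `[0, 1].
Proof.
have /andP[a0 a1] := svalP a.
by rewrite in_itv/= /Q1_real ler0q -[X in _ && (_ <= X)](rmorph1 (@ratr R)) ler_rat !ltW.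
Qed.

(** The comb contains the diagonal, so constant sequences are type II points
    with no finite block before the final letter. *)
Lemma typeII_const (a : Q1) : typeII q b (fun=> a).
Proof.
split; last by exists [::], a; rewrite /= prepend_nil.
by move=> k /=; split; [exact: Q1_real01|left; split; first exact: Q1_real01].
Qed.

Lemma language_letter (a : Q1) : language (typeII q b) [:: a].
Proof. by exists (fun=> a); [exact: typeII_const|exists 0%N]. Qed.

End TypeII.

(** * The subshift algebra of the type II points *)

Theorem proposition5p1 (R : realType) (q : nat -> Q1) (b : nat -> R)
    (q_enum : bijective q)
    (b01 : forall n, 0 <= b n <= 1)
    (q_lt_b : forall n, Q1_real R (q n) < b n)
    (b_sub_q : (fun n => b n - Q1_real R (q n)) @ \oo --> (0 : R))
    (O : cstarType R) (p : set (nat -> Q1) -> O) (s : Q1 -> O)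
    (O_univ : is_subshift_algebra (typeII q b) p s) :
  let X := typeII q b in
  [/\ (* i *) forall a c : Q1,
        star (s a) * s c = (a == c)%:R * p (follower X [:: a]),
      (* ii *) forall al be, language X al -> language X be ->
        GRing.comm (star (word_prod s al) * word_prod s al)
                   (star (word_prod s be) * word_prod s be),
      (* iii *) forall al be, language X al -> language X be ->
        GRing.comm (star (word_prod s al) * word_prod s al)
                   (word_prod s be * star (word_prod s be)),
      (* iv *) forall al be, language X al -> language X be ->
        ~ language X (al ++ be) -> word_prod s al * word_prod s be = 0 &
      (* v *) cstar_generated_by
        (range s `|` range (fun a => star (s a)) `|` [set 1])].
Proof.
have [rels gen _] := O_univ; set X := typeII q b.
split.
- move=> a c; have [<-|/eqP neq] := eqVneq a c.
    rewrite mul1r -(source_word_prod rels (language_letter q b a)).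
    by rewrite word_prod1.
  by rewrite mul0r; apply: (star_letter_mul_eq0 rels) => //; apply: language_letter.
- move=> al be Lal Lbe; rewrite !(source_word_prod rels)//.
  by apply: (comm_pUalg rels); apply: Ualg_follower.
- move=> al be Lal Lbe; rewrite (source_word_prod rels)// (range_word_prod rels)//.
  by apply: (comm_pUalg rels); [apply: Ualg_follower|apply: Ualg_cylinder].
- exact: (word_prod_mul_eq0 rels).
- rewrite /cstar_generated_by; set M := smallest _ _.
  have MA : cstar_subalgebra M by exact: smallest_cstar_subalgebra.
  have M1 : M 1 by move=> N [_]; apply; right.
  have Ms a : M (s a) by move=> N [_]; apply; left; left; exists a.
  rewrite -subTset -gen => x; apply; split=> // _ [[B UB <-]|[a _ <-]//].
  exact: (pUalg_mem rels).
Qed.
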